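(* Let $N\in\mathbb{N}$ and let the weights satisfy $\tilde w_{i,j}>0$ for all $1\le i,j\le N$. Given $N$ distinct positions $v_i\in(0,1)$ in increasing order and the penaliser function $\Psi=\Psi_{a,1}$ with $a>0$, the unique minimiser of $$E(v,W)=\frac14\sum_{i=1}^{2N}\sum_{j=1}^{2N}w_{i,j}\,\Psi\big((v_j-v_i)^2\big)$$ is given by $$v_i^*=\frac{\sum_{j=1}^{i}\tilde w_{i,j}-\frac12\tilde w_{i,i}}{\sum_{j=1}^{N}\tilde w_{i,j}},\qquad i=1,\ldots,N.$$
   Context: The energy is considered for extended position vectors $v=(v_1,\ldots,v_{2N})^{\mathrm T}$ where $v_1,\ldots,v_N\in(0,1)$ and $v_{2N+1-i}:=2-v_i\in(1,2)$ for $i=1,\ldots,N$. The constant weight matrix $W=(w_{i,j})\in(\mathbb{R}_0^+)^{2N\times 2N}$ satisfies $w_{i,j}=w_{i,2N+1-j}=w_{2N+1-i,j}=w_{2N+1-i,2N+1-j}$ for $1\le i,j\le N$, and $\tilde W=(\tilde w_{i,j})$ denotes its upper-left $N\times N$ submatrix. The associated evolution, regarded as the gradient descent of $E$, is $\partial_t v_i=\sum_{j:\,v_j\ne v_i}\tilde w_{i,j}\Phi(v_j-v_i)-\sum_{j=1}^N\tilde w_{i,j}\Phi(v_j+v_i)$, $i=1,\ldots,N$, with flux $\Phi(s)=\Psi'(s^2)\,s$ (half the derivative of $s\mapsto\Psi(s^2)$). The penaliser $\Psi_{a,1}$ is given by $\Psi_{a,1}(s^2)=a\big((s-1)^2-1\big)$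 for $s\in[0,1]$; $s\mapsto\Psi_{a,1}(s^2)$ is extended to $[-1,1]$ by symmetry (evenness) and to $\mathbb{R}$ by periodicity $\Psi((2+s)^2)=\Psi(s^2)$.
   Formalization: The weights w̃ are assumed symmetric, and v* is shown to be the unique minimiser over increasing positions in (0,1) provided v* is itself increasing; in general any minimiser equals v*. Without symmetry or increasing v* the claim is false. *)

(* Defs.v *)
From mathcomp Require Import all_boot all_order all_algebra.
From mathcomp Require Import reals.
From mathcomp Require Import lra.

Set Implicit Arguments.
Unset Strict Implicit.
Unset Printing Implicit Defensive.

Import Order.TTheory GRing.Theory Num.Theory.
Local Open Scope ring_scope.

Section Penaliser.
Variable R : realType.
Implicit Types a s x : R.

(* The representative in [-1, 1) of [s] modulo 2. *)
Definition wrap s : R := s - 2 * (Num.floor ((s + 1) / 2))%:~R.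

(* Psi_{a,1} as a function of the squared distance [x]: it is pinned down on
   [0, +oo) by the three lemmas below; negative arguments never occur. *)
Definition penaliser a x : R := a * ((`|wrap (Num.sqrt x)| - 1) ^+ 2 - 1).

Lemma penaliser_unit_itv a s :
  0 <= s <= 1 -> penaliser a (s ^+ 2) = a * ((s - 1) ^+ 2 - 1).
Proof.
move=> /andP[s0 s1]; rewrite /penaliser sqrtr_sqr (ger0_norm s0).
have [->|s_neq1] := eqVneq s 1.
  have -> : wrap 1 = -1.
    rewrite /wrap; have -> : (1 + 1) / 2 = 1%:~R :> R by lra.
    by rewrite intrKfloor; lra.
  by rewrite normrN1.
have lt_s1 : s < 1 by rewrite lt_neqAle s_neq1.
have fl0 : Num.floor ((s + 1) / 2) = 0.
  by apply: floor_def; apply/andP; split; lra.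
by rewrite /wrap fl0 mulr0 subr0 (ger0_norm s0).
Qed.

Lemma penaliser_even a s : penaliser a ((- s) ^+ 2) = penaliser a (s ^+ 2).
Proof. by rewrite sqrrN. Qed.

Lemma wrapD2 s : wrap (2 + s) = wrap s.
Proof.
rewrite /wrap; have -> : (2 + s + 1) / 2 = 1%:~R + (s + 1) / 2 by lra.
by rewrite floorDzr ?intr_int // intrKfloor intrD; lra.
Qed.

Lemma norm_wrapN s : `|wrap (- s)| = `|wrap s|.
Proof.
rewrite {2}/wrap; set m := Num.floor ((s + 1) / 2).
have lem : m%:~R <= (s + 1) / 2 by apply: floor_le.
have ltm : (s + 1) / 2 < m%:~R + 1.
  by have := floorD1_gt ((s + 1) / 2); rewrite intrD.
have [eqm|neqm] := eqVneq ((s + 1) / 2) m%:~R.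
  have fl : Num.floor ((- s + 1) / 2) = 1 - m.
    have -> : (- s + 1) / 2 = (1 - m)%:~R by rewrite intrB; lra.
    exact: intrKfloor.
  by rewrite /wrap fl intrB; congr `| _ |; lra.
have gtm : m%:~R < (s + 1) / 2 by rewrite lt_neqAle eq_sym neqm.
have fl : Num.floor ((- s + 1) / 2) = - m.
  by apply: floor_def; rewrite intrD intrN; apply/andP; split; lra.
by rewrite /wrap fl intrN -normrN; congr `| _ |; lra.
Qed.

Lemma penaliser_periodic a s :
  penaliser a ((2 + s) ^+ 2) = penaliser a (s ^+ 2).
Proof.
have wn t : `|wrap `|t| | = `|wrap t|.
  by case: (ger0P t) => _ //; rewrite norm_wrapN.
by rewrite /penaliser !sqrtr_sqr !wn wrapD2.
Qed.

End Penaliser.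

Section Model.
Variables (R : realType) (N : nat).

(* With indices counted from 0, [rev_ord] on ['I_(N + N)] is the reflection
   i |-> 2N + 1 - i, and the second half of an extended vector lists the
   mirrored positions 2 - v_N, ..., 2 - v_1 in this order. *)
Definition extend (v : 'rV[R]_N) : 'rV[R]_(N + N) :=
  row_mx v (\row_j (2 - v 0 (rev_ord j))).

(* Nonnegativity and mirror symmetry of the weights only; W is not required
   here to be symmetric as a matrix. *)
Definition weight_matrix (W : 'M[R]_(N + N)) : Prop :=
  (forall p q, 0 <= W p q) /\
  (forall i j : 'I_N,
     let p := lshift N i in let q := lshift N j in
     [/\ W p q = W p (rev_ord q), W p q = W (rev_ord p) q
       & W p q = W (rev_ord p) (rev_ord q)]).

Definition energy (Psi : R -> R) (W : 'M[R]_(N + N)) (u : 'rV[R]_(N + N)) : R :=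
  4^-1 * \sum_p \sum_q W p q * Psi ((u 0 q - u 0 p) ^+ 2).

Definition increasing_positions (v : 'rV[R]_N) : Prop :=
  (forall i, 0 < v 0 i < 1) /\ (forall i j : 'I_N, (i < j)%N -> v 0 i < v 0 j).

Definition vstar (w : 'M[R]_N) : 'rV[R]_N :=
  \row_i ((\sum_(j < N | (j <= i)%N) w i j - 2^-1 * w i i) / \sum_j w i j).

End Model.

Definition minimiser (R : realType) (T : Type) (D : T -> Prop) (f : T -> R)
    (x : T) : Prop :=
  D x /\ forall y, D y -> f x <= f y.

Definition unique_minimiser (R : realType) (T : Type) (D : T -> Prop)
    (f : T -> R) (x : T) : Prop :=
  D x /\ forall y, D y -> y <> x -> f x < f y.

(* Main.v *)
Require Import Defs.
From mathcomp Require Import all_boot all_order all_algebra.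
From mathcomp Require Import reals.
From mathcomp Require Import ring lra.

(** On increasing positions the two terms coming from a pair [i <= j] add up to
    [2 a ((v_j - 1)^2 + v_i^2 - 1)]: the mixed products cancel, so the energy
    is a separable quadratic, and completing squares gives
    [E v = 2 a \sum_i S_i (v_i - v*_i)^2 + const] with [S_i] the row sums of
    the weights.  Since the increasing positions form an open set, a minimiser
    of [E] over this set can only be [v*]. *)

Set Implicit Arguments.
Unset Strict Implicit.
Unset Printing Implicit Defensive.

Import Order.TTheory GRing.Theory Num.Theory.
Local Open Scope ring_scope.

(** Evenness and period 2 make the penaliser symmetric about [s = 1], and so is the parabola. *)
Lemma penaliser_itv02 (R : realType) (a s : R) :
  0 <= s <= 2 -> penaliser a (s ^+ 2) = a * ((s - 1) ^+ 2 - 1).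
Proof.
move=> /andP[s0 s2]; have [s1|s1] := leP s 1.
  by rewrite penaliser_unit_itv // s0.
have -> : s = 2 + - (2 - s) by ring.
rewrite penaliser_periodic penaliser_even penaliser_unit_itv; first by ring.
by apply/andP; split; lra.
Qed.

Lemma rev_lshift (N : nat) (i : 'I_N) : rev_ord (lshift N i) = rshift N (rev_ord i).
Proof. by apply: val_inj => /=; rewrite addnBA. Qed.

Lemma sum_mirror (V : nmodType) (N : nat) (F : 'I_(N + N) -> V) :
  \sum_p F p = \sum_(i < N) (F (lshift N i) + F (rev_ord (lshift N i))).
Proof.
rewrite big_split_ord big_split /=; congr (_ + _).
rewrite (reindex_inj rev_ord_inj) /=.
by apply: eq_bigr => i _; rewrite rev_lshift.
Qed.

Section Extend.
Variables (R : realType) (N : nat).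
Implicit Types (v : 'rV[R]_N) (i : 'I_N).

Lemma extend_lshift v i : extend v 0 (lshift N i) = v 0 i.
Proof. by rewrite row_mxEl. Qed.

Lemma extend_mirror v i : extend v 0 (rev_ord (lshift N i)) = 2 - v 0 i.
Proof. by rewrite rev_lshift row_mxEr mxE rev_ordK. Qed.

(** Each [(i, j)] and its mirror images give four terms of equal weight. Up to sign, two have
    difference [v_j - v_i] and two have [v_j + v_i - 2], which the period turns into [v_j + v_i]. *)
Lemma energy_extend (Psi : R -> R) (W : 'M[R]_(N + N)) v :
    (forall s, Psi ((2 + s) ^+ 2) = Psi (s ^+ 2)) -> weight_matrix W ->
  energy Psi W (extend v) = 2^-1 * \sum_i \sum_j ulsubmx W i j *
    (Psi ((v 0 j - v 0 i) ^+ 2) + Psi ((v 0 j + v 0 i) ^+ 2)).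
Proof.
move=> PsiP [_ Wmirror]; rewrite /energy sum_mirror !mulr_sumr.
apply: eq_bigr => i _; rewrite !sum_mirror -big_split !mulr_sumr.
apply: eq_bigr => j _ /=.
have [W1 W2 W3] := Wmirror i j.
rewrite -W1 -W2 -W3 !extend_lshift !extend_mirror !mxE.
have -> : (2 - v 0 j - (2 - v 0 i)) ^+ 2 = (v 0 j - v 0 i) ^+ 2 by ring.
have -> : (2 - v 0 j - v 0 i) ^+ 2 = (v 0 j - (2 - v 0 i)) ^+ 2 by ring.
have -> : (v 0 j + v 0 i) ^+ 2 = (2 + (v 0 j - (2 - v 0 i))) ^+ 2 by ring.
by rewrite PsiP; field.
Qed.

End Extend.

(** Both arguments lie in [[0, 2]], where a single parabola describes the penaliser. The case
    [x = y] serves the diagonal pairs. *)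
Lemma penaliser_pair (R : realType) (a x y : R) : 0 < x -> x <= y -> y < 1 ->
  penaliser a ((y - x) ^+ 2) + penaliser a ((y + x) ^+ 2) =
  2 * a * ((y - 1) ^+ 2 + x ^+ 2 - 1).
Proof.
move=> x0 xy y1; rewrite !penaliser_itv02; first by ring.
all: by apply/andP; split; lra.
Qed.

Section SymmetricWeights.
Variables (R : realType) (N : nat) (W : 'M[R]_(N + N)) (a : R).
Local Notation w := (ulsubmx W).
Hypotheses (hW : weight_matrix W) (hpos : forall i j, 0 < w i j)
  (hsym : forall i j, w i j = w j i).
Implicit Types (v : 'rV[R]_N) (i j : 'I_N).

Lemma row_sum_gt0 i : 0 < \sum_j w i j.
Proof.
rewrite (bigD1 i) //= ltr_pwDl //.
by apply: sumr_ge0 => j _; apply/ltW.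
Qed.

Lemma energy_increasing v : increasing_positions v ->
  energy (penaliser a) W (extend v) =
  a * \sum_i \sum_j w i j *
    (2 * (if (j < i)%N then (v 0 i - 1) ^+ 2
          else if j == i then 2^-1 * ((v 0 i - 1) ^+ 2 + v 0 i ^+ 2)
          else v 0 i ^+ 2) - 1).
Proof.
move=> [v01 vincr]; rewrite (energy_extend _ (penaliser_periodic a) hW).
(* [h i j] is the share of the pair [(i, j)] that depends on [v_i]. *)
pose h i j := if (j < i)%N then (v 0 i - 1) ^+ 2
  else if j == i then 2^-1 * ((v 0 i - 1) ^+ 2 + v 0 i ^+ 2) else v 0 i ^+ 2.
have pair i j : penaliser a ((v 0 j - v 0 i) ^+ 2)
    + penaliser a ((v 0 j + v 0 i) ^+ 2) = 2 * a * (h i j + h j i - 1).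
  have /andP[i0 i1] := v01 i; have /andP[j0 j1] := v01 j.
  rewrite /h; case: (ltngtP i j) => [ij|ji|/val_inj <-].
  - rewrite penaliser_pair // ?ltW ?vincr //.
    by rewrite [j == i]eq_sym (negPf (_ : i != j)) ?neq_ltn ?ij //; ring.
  - have -> : (v 0 j - v 0 i) ^+ 2 = (v 0 i - v 0 j) ^+ 2 by ring.
    rewrite [v 0 j + _]addrC penaliser_pair // ?ltW ?vincr //.
    by rewrite (negPf (_ : i != j)) ?neq_ltn ?ji ?orbT.
  - by rewrite penaliser_pair // eqxx; field.
transitivity (a * (\sum_i \sum_j w i j * (h i j - 2^-1)
                   + \sum_i \sum_j w i j * (h j i - 2^-1))).
  rewrite -big_split !mulr_sumr; apply: eq_bigr => i _ /=.
  rewrite -big_split !mulr_sumr; apply: eq_bigr => j _ /=.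
  by rewrite pair; field.
(* After swapping the summations, symmetry of the weights identifies the second double sum with the
   first. *)
rewrite [X in _ + X]exchange_big /= -big_split.
congr (_ * _); apply: eq_bigr => i _; rewrite -big_split /=.
by apply: eq_bigr => j _; rewrite hsym -/(h i j); field.
Qed.

Lemma energy_squares : exists C : R, forall v, increasing_positions v ->
  energy (penaliser a) W (extend v) =
  2 * a * \sum_i (\sum_j w i j) * (v 0 i - vstar w 0 i) ^+ 2 + C.
Proof.
pose S i := \sum_j w i j.
pose P i := \sum_(j < N | (j <= i)%N) w i j.
(* What remains of each row once the square around [vstar] is split off. *)
exists (a * \sum_i (2 * P i - w i i - S i - 2 * S i * vstar w 0 i ^+ 2)).
move=> v vD; rewrite energy_increasing // -mulrA [2 * (a * _)]mulrCA -mulrDr.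
congr (_ * _); rewrite mulr_sumr -big_split; apply: eq_bigr => i _ /=.
have S0 : S i != 0 by rewrite gt_eqF // row_sum_gt0.
have vE : S i * vstar w 0 i = P i - 2^-1 * w i i.
  by rewrite !mxE mulrC divfK.
have -> : 2 * (S i * (v 0 i - vstar w 0 i) ^+ 2) +
    (2 * P i - w i i - S i - 2 * S i * vstar w 0 i ^+ 2) =
    2 * S i * v 0 i ^+ 2 - 4 * (S i * vstar w 0 i) * v 0 i
    + (2 * P i - w i i - S i) by ring.
rewrite vE.
(* Take [2 v_i^2 - 1] for every [j], add [2 - 4 v_i] to reach [2 (v_i - 1)^2 - 1] for [j <= i], and
   undo half of this on the diagonal. *)
transitivity (S i * (2 * v 0 i ^+ 2 - 1) + P i * (2 - 4 * v 0 i)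
              + w i i * (2 * v 0 i - 1)); last by field.
rewrite /S /P [\sum_(j < N | (j <= i)%N) _]big_mkcond !mulr_suml -big_split /=.
rewrite !(bigD1 (P := xpredT) i) //= leqnn ltnn eqxx.
rewrite addrAC; congr (_ + _); first by field.
apply: eq_bigr => j ji; rewrite (negPf ji) ltn_neqAle (ji : (j : nat) != i) /=.
by case: ifP => _; ring.
Qed.

End SymmetricWeights.

(** The sum [M] bounds every ratio [|g i| / f i], so [t = 1 / (1 + M)] gives [t |g i| < f i]. *)
Lemma pos_perturb (R : realFieldType) (I : finType) (f g : I -> R) :
  (forall i, 0 < f i) ->
  exists2 t : R, 0 < t <= 1 & forall i, 0 < f i + t * g i.
Proof.
move=> f0; pose M := \sum_i `|g i| / f i.
have q0 i : 0 <= `|g i| / f i by rewrite divr_ge0 // ltW.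
have M0 : 0 <= M by apply: sumr_ge0.
have M1 : 0 < 1 + M by lra.
exists (1 + M)^-1; first by rewrite invr_gt0 M1 invf_le1 //; lra.
move=> i; have gM : `|g i| / f i <= M.
  by rewrite /M (bigD1 i) //= lerDl sumr_ge0.
have gf : `|g i| < (1 + M) * f i by rewrite -ltr_pdivrMr //; lra.
rewrite mulrC -(pmulr_lgt0 _ M1) mulrDl divfK ?gt_eqF //.
by have := ler_norm (- g i); rewrite normrN; lra.
Qed.

Lemma increasing_positions_open (R : realType) (N : nat) (v d : 'rV[R]_N) :
  increasing_positions v ->
  exists2 t : R, 0 < t <= 1 & increasing_positions (v + t *: d).
Proof.
move=> [v01 vincr].
(* [f] lists the slacks of all the strict inequalities at [v], and [g] their slopes along [d]. Pairs
   without [i < j] get the harmless slack 1 and slope 0. *)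
pose f (k : 'I_N + 'I_N + 'I_N * 'I_N) : R := match k with
  | inl (inl i) => v 0 i
  | inl (inr i) => 1 - v 0 i
  | inr (i, j) => if (i < j)%N then v 0 j - v 0 i else 1
  end.
pose g (k : 'I_N + 'I_N + 'I_N * 'I_N) : R := match k with
  | inl (inl i) => d 0 i
  | inl (inr i) => - d 0 i
  | inr (i, j) => if (i < j)%N then d 0 j - d 0 i else 0
  end.
have f0 k : 0 < f k.
  case: k => [[i|i]|[i j]] /=; try by have := v01 i; lra.
  by case: ifP => // ij; rewrite subr_gt0 vincr.
have [t t01 tP] := pos_perturb g f0; exists t => //; split=> [i|i j ij].
  have := tP (inl (inl i)); have := tP (inl (inr i)).
  by rewrite /= !mxE => h1 h2; apply/andP; split; lra.
by have := tP (inr (i, j)); rewrite /= ij !mxE; lra.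
Qed.

Theorem theorem6 (R : realType) (N : nat) (W : 'M[R]_(N + N)) (a : R)
    (hW : weight_matrix W)
    (hpos : forall i j : 'I_N, 0 < (ulsubmx W) i j)
    (hsym : forall i j : 'I_N, (ulsubmx W) i j = (ulsubmx W) j i)
    (ha : 0 < a) :
  let E := fun v : 'rV[R]_N => energy (penaliser a) W (extend v) in
  let v0 := vstar (ulsubmx W) in
  (increasing_positions v0 -> unique_minimiser (@increasing_positions R N) E v0)
  /\ (forall v : 'rV[R]_N,
        minimiser (@increasing_positions R N) E v -> v = v0).
Proof.
move=> E v0; have [C EC] := energy_squares a hW hpos hsym.
pose Q (v : 'rV[R]_N) := \sum_i (\sum_j ulsubmx W i j) * (v 0 i - v0 0 i) ^+ 2.
have Q0 : Q v0 = 0 by apply: big1 => i _; rewrite subrr expr0n mulr0.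
have S0 i := row_sum_gt0 hpos i.
(* A vanishing sum of nonnegative terms has only zero terms, and the row sums are positive. *)
have Qgt0 v : v <> v0 -> 0 < Q v.
  move=> /eqP; apply: contra_neqT; rewrite -leNgt => Qv.
  have term0 i : true -> 0 <= (\sum_j ulsubmx W i j) * (v 0 i - v0 0 i) ^+ 2.
    by rewrite mulr_ge0 ?sqr_ge0 // ltW.
  have /eqP : Q v = 0 by apply/le_anti; rewrite Qv sumr_ge0.
  rewrite psumr_eq0 // => /allP Qi; apply/rowP => i.
  have := Qi i (mem_index_enum i).
  by rewrite /= mulf_eq0 gt_eqF //= sqrf_eq0 subr_eq0 => /eqP.
split=> [v0D|v [vD vmin]].
  split=> // v vD /Qgt0 Qv; rewrite /E !EC // -/(Q v) -/(Q v0) Q0.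
  by rewrite ltrD2r mulr0 !mulr_gt0.
have [//|/eqP/Qgt0 Qv] := eqVneq v v0.
(* As [v0] may lie outside the domain, only a small step from [v] towards it is taken. It scales [Q]
   by [(1 - t)^2 < 1], which contradicts minimality of [v]. *)
have [t /andP[t0 t1] utD] := increasing_positions_open (v0 - v) vD.
have := vmin _ utD; rewrite /E !EC // -/(Q v) -/(Q _) lerD2r.
have -> : Q (v + t *: (v0 - v)) = (1 - t) ^+ 2 * Q v.
  by rewrite mulr_sumr; apply: eq_bigr => i _; rewrite !mxE; ring.
rewrite ler_pM2l ?mulr_gt0 // leNgt gtr_pMl // => /negP[].
by rewrite expr_lt1 ?subr_ge0 // gtrBl.
Qed.
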